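(* Let $R$ be a commutative ring with identity and let $M$ be a faithful finitely generated coreduced comultiplication $R$-module. Then for each $a \in R$, $$V^s\big((0:_M \mathrm{Ann}_R(a))\big) = \mathrm{Max}^s(M) \setminus V^s\big((0:_M a)\big).$$
   Context: For a submodule $N$ of $M$, $r\in R$ and an ideal $I$ of $R$: $(N:_M I)=\{m\in M: Im\subseteq N\}$, $(N:_M r)=\{m\in M: rm\in N\}$. $M$ is a comultiplication module if for every submodule $N$ of $M$ there is an ideal $I$ of $R$ with $N=(0:_M I)$. A proper submodule $N$ of $M$ is completely irreducible if $N=\bigcap_{i\in I}N_i$, for a family $\{N_i\}_{i\in I}$ of submodules of $M$, implies $N=N_i$ for some $i$. $M$ is coreduced if for every $r\in R$ and every completely irreducible submodule $L$ of $M$, $(L:_M r)=M$ implies $L+(0:_M r)=M$. A non-zero submodule $N$ of $M$ is second if for each $a\in R$ the multiplication map $N\xrightarrow{a}N$ is either surjective or zero. A second submodule $N$ of $M$ is a maximal second submodule of $M$ if there is no second submodule $L$ of $M$ with $N\subsetneq L\subseteq M$. $\mathrm{Max}^s(M)$ is the set of all maximal second submodules of $M$, and for a submodule $N$ of $M$, $V^s(N)=\{S\in \mathrm{Max}^s(M): S\subseteq N\}$. *)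

(* Defs.v *)
From HB Require Import structures.
From mathcomp Require Import all_boot all_order all_algebra.
From mathcomp Require Import boolp classical_sets functions.

Set Implicit Arguments.
Unset Strict Implicit.
Unset Printing Implicit Defensive.

Import GRing.Theory.
Local Open Scope classical_set_scope.
Local Open Scope ring_scope.

Definition submodule (R : comPzRingType) (M : lmodType R) (N : set M) : Prop :=
  GRing.submod_closed (mem N).

(* [idealr_closed] of the library only covers proper ideals; here the unit
   ideal is allowed, an ideal being a submodule of the regular module. *)
Definition ideal (R : comPzRingType) (I : set R) : Prop :=
  @submodule R R^o I.

Definition colon_ideal (R : comPzRingType) (M : lmodType R)
  (N : set M) (I : set R) : set M :=
  [set m | [set r *: m | r in I] `<=` N].

Definition colon_elt (R : comPzRingType) (M : lmodType R)
  (N : set M) (r : R) : set M :=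
  [set m | N (r *: m)].

Definition add_submod (R : comPzRingType) (M : lmodType R)
  (N K : set M) : set M :=
  [set x + y | x in N & y in K].

Definition ann (R : comPzRingType) (a : R) : set R := [set r | r * a = 0].

Definition faithful_module (R : comPzRingType) (M : lmodType R) : Prop :=
  forall r : R, (forall m : M, r *: m = 0) -> r = 0.

Definition finitely_generated (R : comPzRingType) (M : lmodType R) : Prop :=
  exists (n : nat) (g : 'I_n -> M), forall m : M,
    exists c : 'I_n -> R, m = \sum_(i < n) c i *: g i.

Definition comultiplication (R : comPzRingType) (M : lmodType R) : Prop :=
  forall N : set M, submodule N ->
    exists I : set R, ideal I /\ N = colon_ideal [set 0] I.

Definition completely_irreducible (R : comPzRingType) (M : lmodType R)
  (N : set M) : Prop :=
  [/\ submodule N, N <> [set: M] &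
    forall (I : Type) (F : I -> set M), (forall i, submodule (F i)) ->
      N = \bigcap_i F i -> exists i, N = F i].

Definition coreduced (R : comPzRingType) (M : lmodType R) : Prop :=
  forall (r : R) (L : set M), completely_irreducible L ->
    colon_elt L r = [set: M] ->
    add_submod L (colon_elt [set 0] r) = [set: M].

Definition second (R : comPzRingType) (M : lmodType R) (N : set M) : Prop :=
  [/\ submodule N, N <> [set 0] &
    forall a : R, set_surj N N ( *:%R a) \/ (forall x, N x -> a *: x = 0)].

Definition max_second (R : comPzRingType) (M : lmodType R) : set (set M) :=
  [set N | second N /\ ~ exists L : set M, second L /\ N `<` L].

Definition Vs (R : comPzRingType) (M : lmodType R) (N : set M) : set (set M) :=
  [set S | max_second S /\ S `<=` N].

(* Main.v *)
Require Import Defs.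
From HB Require Import structures.
From mathcomp Require Import all_boot all_order all_algebra.
From mathcomp Require Import boolp classical_sets functions.
From mathcomp Require Import ring.

(** Coreducedness makes the ring von Neumann regular, and then the equality is
    a statement about an idempotent.

    For r in R put K = rM + (0 :_M r).  If K were proper it would lie in a
    completely irreducible L ([completely_irreducible_separation]); as rM is
    contained in L, coreducedness gives L + (0 :_M r) = M, and since (0 :_M r)
    is contained in L as well this forces L = M, a contradiction.  Hence
    M = rM + (0 :_M r) ([coreduced_split]): multiplication by r is onto on the
    finitely generated module M / (0 :_M r).  Nakayama's lemma ([nakayama_mod])
    yields t such that 1 - r t kills that quotient, that is r (1 - r t) M = 0,
    and faithfulness gives r (1 - r t) = 0 ([coreduced_regular]).

    Now let S be second.  If S were killed by both a and Ann(a), it would be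
    killed by 1 = a t + (1 - a t), because 1 - a t lies in Ann(a); but S is
    non-zero.  If S is not killed by a then aS = S, so
    Ann(a) S = Ann(a) a S = 0.  Thus exactly one of a and Ann(a) kills S. *)

Set Implicit Arguments.
Unset Strict Implicit.
Unset Printing Implicit Defensive.

Import GRing.Theory.
Local Open Scope classical_set_scope.
Local Open Scope ring_scope.

Lemma submoduleP (R : comPzRingType) (M : lmodType R) (N : set M) :
  submodule N <-> N 0 /\ forall (a : R) u v, N u -> N v -> N (a *: u + v).
Proof.
split=> [[N0 Nlin]|[N0 Nlin]].
  split; first exact: set_mem N0.
  by move=> a u v Nu Nv; apply: set_mem; apply: Nlin; exact: mem_set.
split; first exact: mem_set.
by move=> a u v /set_mem Nu /set_mem Nv; apply: mem_set; exact: Nlin.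
Qed.

Section Submodules.
Context (R : comPzRingType) (M : lmodType R) (N : set M).
Hypothesis hN : submodule N.

Lemma submodule0 : N 0.
Proof. by case: (submoduleP N).1. Qed.

Lemma submoduleZ (a : R) u : N u -> N (a *: u).
Proof.
by move=> Nu; rewrite -[_ *: _]addr0; apply: ((submoduleP N).1 hN).2 => //;
  exact: submodule0.
Qed.

Lemma submoduleD u v : N u -> N v -> N (u + v).
Proof.
by move=> Nu Nv; rewrite -[u]scale1r; exact: ((submoduleP N).1 hN).2.
Qed.

End Submodules.

Lemma colon_elt_submodule (R : comPzRingType) (M : lmodType R) (N : set M)
  (r : R) : submodule N -> submodule (colon_elt N r).
Proof.
move=> hN; apply/submoduleP; split; rewrite /colon_elt /=.
  by rewrite scaler0; exact: submodule0.
move=> a u v Nu Nv; rewrite scalerDr scalerA mulrC -scalerA.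
by apply: submoduleD => //; exact: submoduleZ.
Qed.

Lemma zero_submodule (R : comPzRingType) (M : lmodType R) :
  submodule [set 0 : M].
Proof.
apply/submoduleP; split=> //= a u v -> ->.
by rewrite scaler0 addr0.
Qed.

Lemma range_scale_submodule (R : comPzRingType) (M : lmodType R) (r : R) :
  submodule (range ( *:%R r : M -> M)).
Proof.
apply/submoduleP; split; first by exists 0 => //; rewrite scaler0.
move=> a _ _ [u _ <-] [v _ <-]; exists (a *: u + v) => //.
by rewrite scalerDr !scalerA mulrC.
Qed.

Lemma add_submod_submodule (R : comPzRingType) (M : lmodType R)
  (N K : set M) : submodule N -> submodule K -> submodule (add_submod N K).
Proof.
move=> hN hK; apply/submoduleP; split.
  by exists 0; [exact: submodule0|exists 0; [exact: submodule0|rewrite addr0]].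
move=> a _ _ [u Nu [v Kv <-]] [u' Nu' [v' Kv' <-]].
exists (a *: u + u'); first by apply: submoduleD => //; exact: submoduleZ.
exists (a *: v + v'); first by apply: submoduleD => //; exact: submoduleZ.
by rewrite scalerDr addrACA.
Qed.

(** A submodule maximal among those containing K and avoiding x is completely
    irreducible: if it is an intersection, some member of the family avoids x,
    and that member is then the submodule itself by maximality. *)
Lemma completely_irreducible_separation (R : comPzRingType) (M : lmodType R)
  (K : set M) (x : M) :
  submodule K -> ~ K x ->
  exists L, [/\ completely_irreducible L, K `<=` L & ~ L x].
Proof.
move=> hK Kx.
(* Adjoining K to each member lets the empty chain have an upper bound too. *)
pose P X := submodule (X `|` K) /\ ~ (X `|` K) x.
have [|A [[hA Ax] Amax]] := @Zorn_bigcup _ P.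
  move=> F FP Ftot; split; last first.
    by move=> [[X FX Xx]|//]; apply: (FP _ FX).2; left.
  have step X (a : R) u v : F X -> (X `|` K) u -> (X `|` K) v ->
      (\bigcup_(X in F) X `|` K) (a *: u + v).
    move=> FX Xu Xv; have hX := (FP _ FX).1.
    have [|] : (X `|` K) (a *: u + v).
      by apply: submoduleD => //; exact: submoduleZ.
    - by left; exists X.
    - by right.
  apply/submoduleP; split; first by right; exact: submodule0.
  move=> a u v [[X FX Xu]|Ku] [[Y FY Yv]|Kv].
  - have [XY|YX] := Ftot _ _ FX FY.
    + by apply: (step Y) => //; left => //; exact: XY.
    + by apply: (step X) => //; left => //; exact: YX.
  - by apply: (step X) => //; [left|right].
  - by apply: (step Y) => //; [right|left].
  - by right; apply: submoduleD => //; exact: submoduleZ.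
exists (A `|` K); split; [|by move=> y Ky; right|by []].
have maxL N : submodule N -> A `|` K `<=` N -> ~ N x -> A `|` K = N.
  move=> hN LN Nx; have NK : N `|` K = N.
    by apply/setUidPl => y Ky; apply: LN; right.
  have AN : A `<=` N by move=> y Ay; apply: LN; left.
  apply/seteqP; split=> // y Ny; left; apply: contrapT => Ay.
  apply: (Amax N); last by rewrite /P NK.
  by split=> // NA; apply: Ay; exact: NA.
split=> // [LT|I F hF LF]; first by apply: Ax; rewrite LT.
have [i Fix] : exists i, ~ F i x.
  by apply: contrapT => nF; apply: Ax; rewrite LF => i _; apply: contrapT => ?;
    apply: nF; exists i.
by exists i; apply: maxL => //; rewrite LF; exact: bigcap_inf.
Qed.

(** Elimination behind Nakayama's lemma: K is the submodule modulo which one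
    computes, and 1 - r t is a partially built annihilator mapping M into the
    r-span of the remaining generators.  Applied to the first remaining
    generator g0, the hypothesis expresses (1 - r (t + c)) g0 through the
    other ones, so multiplying by 1 - r (t + c) eliminates g0. *)
Lemma nakayama_elimination (R : comPzRingType) (M : lmodType R) (K : set M)
  (r : R) (n : nat) (g : 'I_n -> M) (t : R) :
  submodule K ->
  (forall x, exists c : 'I_n -> R,
     K ((1 - r * t) *: x - r *: \sum_(i < n) c i *: g i)) ->
  exists s : R, forall x, K ((1 - r * s) *: x).
Proof.
move=> hK; elim: n g t => [|n IHn] g t hg.
  by exists t => x; have [c] := hg x; rewrite big_ord0 scaler0 subr0.
have [c] := hg (g ord0); rewrite big_ord_recl.
set c0 := c ord0; set y0 := \sum_(i < n) _ => Ky0.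
(* The new parameter comes from expanding (1 - r (t + c0)) (1 - r t). *)
apply: (IHn (g \o lift ord0) (t + (t + c0) - r * t * (t + c0))) => x.
have [d] := hg x; rewrite big_ord_recl.
set d0 := d ord0; set y := \sum_(i < n) _ => Ky.
exists (fun i => r * d0 * c (lift ord0 i)
                 + (1 - r * (t + c0)) * d (lift ord0 i)).
have -> : \sum_(i < n) (r * d0 * c (lift ord0 i)
    + (1 - r * (t + c0)) * d (lift ord0 i)) *: (g \o lift ord0) i
    = (r * d0) *: y0 + (1 - r * (t + c0)) *: y.
  rewrite !scaler_sumr -big_split; apply: eq_bigr => i _ /=.
  by rewrite !scalerA -scalerDl.
have := submoduleD hK (submoduleZ hK (1 - r * (t + c0)) Ky)
  (submoduleZ hK (r * d0) Ky0).
congr K.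
rewrite !(scalerBr, scalerDr, scalerA, opprD).
rewrite [r * d0 * _ *: g ord0 + _]addrA -scalerBl.
(* The two coefficients of g0 cancel. *)
have -> : (1 - r * (t + c0)) * r * d0 = r * d0 * (1 - r * t) - r * d0 * r * c0.
  by ring.
rewrite -addrA; congr (_ *: _ + _); first by ring.
rewrite [- _ - _]addrC -addrA addKr addrC.
by congr (- (_ *: _) - _ *: _); ring.
Qed.

(** Nakayama's lemma for the module M / K on which r acts surjectively. *)
Lemma nakayama_mod (R : comPzRingType) (M : lmodType R) (K : set M) (r : R) :
  finitely_generated M -> submodule K ->
  add_submod (range ( *:%R r : M -> M)) K = [set: M] ->
  exists t : R, forall x, K ((1 - r * t) *: x).
Proof.
move=> [n [g gen]] hK split_M.
apply: (nakayama_elimination (g := g) (t := 0)) => // x.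
have [_ [y _ <-] [k Kk <-]] : add_submod (range ( *:%R r : M -> M)) K x.
  by rewrite split_M.
have [c yE] := gen y; exists c.
by rewrite -yE mulr0 subr0 scale1r addrC addKr.
Qed.

Lemma coreduced_split (R : comPzRingType) (M : lmodType R) (r : R) :
  coreduced M ->
  add_submod (range ( *:%R r : M -> M)) (colon_elt [set 0] r) = [set: M].
Proof.
move=> hM; have h0 := colon_elt_submodule r (zero_submodule M).
apply/seteqP; split=> // x _; apply: contrapT => nx.
have [L [hL KL Lx]] := completely_irreducible_separation
  (add_submod_submodule (range_scale_submodule M r) h0) nx.
have subL : submodule L by case: hL.
have rML : colon_elt L r = [set: M].
  apply/seteqP; split=> // y _; apply: KL; exists (r *: y); first by exists y.
  by exists 0; [exact: submodule0|rewrite addr0].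
have [y Ly [z z0 yz]] : add_submod L (colon_elt [set 0] r) x.
  by rewrite (hM r L hL rML).
apply: Lx; rewrite -yz; apply: submoduleD => //; apply: KL.
exists 0; first by exists 0 => //; rewrite scaler0.
by exists z => //; rewrite add0r.
Qed.

Lemma coreduced_regular (R : comPzRingType) (M : lmodType R) (r : R) :
  faithful_module M -> finitely_generated M -> coreduced M ->
  exists t : R, ann r (1 - r * t).
Proof.
move=> faithM fgM corM.
have [t ht] := nakayama_mod fgM (colon_elt_submodule r (zero_submodule M))
  (coreduced_split r corM).
by exists t; apply: faithM => m; rewrite mulrC -scalerA; exact: ht.
Qed.

Theorem theorem2p2 (R : comPzRingType) (M : lmodType R)
  (hfaithful : faithful_module M)
  (hfg : finitely_generated M)
  (hcoreduced : coreduced M)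
  (hcomult : comultiplication M)
  (a : R) :
  Vs (colon_ideal [set (0 : M)] (ann a)) =
  @max_second R M `\` Vs (colon_elt [set (0 : M)] a).
Proof.
have [t ht] := coreduced_regular a hfaithful hfg hcoreduced.
apply/seteqP; split=> S.
  move=> [maxS annS]; split=> // -[_ aS].
  case: maxS => -[hS S0 _] _; apply: S0; apply/seteqP; split=> x; last first.
    by move=> ->; exact: submodule0.
  move=> Sx; have /= ax0 : a *: x = 0 := aS x Sx.
  have /= : (1 - a * t) *: x = 0 by apply: (annS x Sx); exists (1 - a * t).
  by rewrite scalerBl scale1r mulrC -scalerA ax0 scaler0 subr0.
move=> [maxS naS]; split=> // x Sx _ [r ra0 <-].
case: (maxS) => -[hS S0 /(_ a)[aSS|aS0]] _; last first.
  by exfalso; apply: naS; split.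
have [y Sy <-] := aSS x Sx.
by rewrite /= scalerA ra0 scale0r.
Qed.
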